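(* Let $n\ge 1$ be an integer and let $[\beta(i,j)]$ be the $n\times n$ matrix with $(i,j)$th entry $\beta(i,j)$, $1\le i,j\le n$, where $\beta$ is the beta function. The inverse of $[\beta(i,j)]$ is an integer matrix (all its entries are integers), with $(i,j)$th entry given by $$(-1)^{n+i-j}\binom{n+i-1}{i-1}\binom{n}{j}\,j\sum_{1\le k\le \min(i,j)}\binom{n-k}{n-i}\binom{n+j-1}{n+k-1}(-1)^k .$$
   Context: For $x,y>0$, $\beta(x,y)=\frac{\Gamma(x)\Gamma(y)}{\Gamma(x+y)}$; for positive integers $i,j$, $\beta(i,j)=\frac{(i-1)!(j-1)!}{(i+j-1)!}$. $\binom{r}{k}$ denotes the binomial coefficient, with $\binom{0}{k}=1$ if $k=0$ and $0$ otherwise. *)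

(* Defs.v *)
From HB Require Import structures.
From mathcomp Require Import all_boot all_order all_algebra.
From mathcomp Require Import all_classical all_reals all_analysis.

Set Implicit Arguments.
Unset Strict Implicit.
Unset Printing Implicit Defensive.
Import Order.TTheory GRing.Theory Num.Theory.
Import numFieldNormedType.Exports.
Local Open Scope classical_set_scope.
Local Open Scope ring_scope.

Definition Gamma (R : realType) (x : R) : R :=
  \int[lebesgue_measure]_(t in `]0, +oo[) (t `^ (x - 1) * expR (- t)).

(* The library's beta_fun is restricted to natural arguments. *)
Definition beta (R : realType) (x y : R) : R :=
  Gamma x * Gamma y / Gamma (x + y).

(* Row i : 'I_n of the matrix is row i.+1 in the usual one-based numbering. *)
Definition beta_matrix (R : realType) (n : nat) : 'M[R]_n :=
  \matrix_(i < n, j < n) beta i.+1%:R j.+1%:R.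

(* i and j are one-based; for 1 <= i, j <= n and 1 <= k <= minn i j none of the
   natural-number subtractions truncates. *)
Definition beta_inv_entry (n i j : nat) : int :=
  (-1) ^+ (n + i - j) * 'C(n + i - 1, i - 1)%:Z * 'C(n, j)%:Z * j%:Z *
  \sum_(1 <= k < (minn i j).+1)
    'C(n - k, n - i)%:Z * 'C(n + j - 1, n + k - 1)%:Z * (-1) ^+ k.

(* Main.v *)
(* Since Gamma(k+1) = k!, everything reduces to factorials.  Multiplying the
   proposed inverse by [beta(i,j)] and summing over j first, the coefficient of
   each k is, up to a factor n!(m-1)!/(n+m-1)!, an alternating sum
   sum_l (-1)^l C(N,l) C(D+N-l,r) = C(D,r-N) with N = n+m-1; the remaining sum
   over k is of the same shape with D = 0, and collapses to the Kronecker
   delta. *)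
Require Import Defs.
From mathcomp Require Import all_boot all_order all_algebra.
From mathcomp Require Import all_classical all_reals all_analysis.
From mathcomp Require Import measurable_realfun ring zify.
Import Order.TTheory GRing.Theory Num.Theory.
Import numFieldNormedType.Exports.
Local Open Scope ring_scope.

(** For t > 0, exp t dominates its Taylor term of degree n + 1, so the quotient is at most (n + 1)!
    / t. *)
Lemma cvg_expr_expRN (R : realType) (n : nat) :
  (t ^+ n * expR (- t) @[t --> +oo] --> (0 : R))%classic.
Proof.
apply/cvgrPdist_le => e e0; near=> t.
have t0 : 0 < t by near: t; apply: nbhs_pinfty_gt.
rewrite sub0r normrN ger0_norm ?mulr_ge0 ?expR_ge0 ?exprn_ge0 ?(ltW t0)//.
rewrite expRN ler_pdivrMr ?expR_gt0// -ler_pdivrMl//.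
apply: le_trans (expR_ge1Dxn n (ltW t0)); apply: ler_wpDl => //.
rewrite exprS mulrAC ler_wpM2r ?exprn_ge0 ?(ltW t0)//.
rewrite ler_pdivlMr ?ltr0n ?fact_gt0//.
Unshelve. all: by end_near. Qed.

(** The upper incomplete gamma function, the integral of s^n exp(-s) over s > t, encoded by its
    integration-by-parts recursion so that its negative is an explicit antiderivative. *)
Fixpoint upper_Gamma (R : realType) (n : nat) (t : R) : R :=
  if n is m.+1 then t ^+ n * expR (- t) + n%:R * upper_Gamma R m t
  else expR (- t).

Lemma upper_Gamma0 (R : realType) n : upper_Gamma R n 0 = n`!%:R.
Proof.
elim: n => [|n IH] /=; first by rewrite oppr0 expR0.
by rewrite IH expr0n mul0r add0r -natrM.
Qed.

Lemma cvg_upper_Gamma (R : realType) n :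
  (upper_Gamma R n t @[t --> +oo] --> (0 : R))%classic.
Proof.
elim: n => [|n IH] /=; first exact: cvgr_expR.
rewrite -[0]addr0; apply: cvgD; first exact: cvg_expr_expRN.
by rewrite -(mulr0 n.+1%:R); apply: cvgMr.
Qed.

(** The term (n + 1) t^n exp(-t) produced by the product rule cancels against the derivative of the
    recursive summand. *)
Lemma is_derive_upper_Gamma (R : realType) n (t : R) :
  is_derive t 1 (upper_Gamma R n) (- (t ^+ n * expR (- t))).
Proof.
have dE : is_derive t (1 : R) (fun x => expR (- x)) (- expR (- t)).
  by apply: is_derive_eq; rewrite mulrN1.
elim: n => [|n IH] /=; first by rewrite expr0 mul1r.
have dX : is_derive t (1 : R) (fun x => x ^+ n.+1) (n.+1%:R * t ^+ n).
  have := is_deriveX n.+1 (is_derive_id t (1 : R)).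
  by rewrite exprfctE /GRing.scale /= mulr1.
have dM := is_deriveM dX dE.
have dZ := is_deriveZ n.+1%:R IH.
apply: is_derive_eq (is_deriveD dM dZ) _.
by rewrite /GRing.scale /=; ring.
Qed.

Lemma Gamma_natS (R : realType) (n : nat) : Gamma (n.+1%:R : R) = n`!%:R.
Proof.
have dG (x : R) := is_derive_upper_Gamma R n x.
have cG : continuous (upper_Gamma R n).
  by move=> x; apply/differentiable_continuous/derivable1_diffP.
have cf : continuous (fun t : R => t ^+ n * expR (- t)).
  move=> x; apply: cvgM; first exact: exprn_continuous.
  by apply: (@continuous_comp _ _ _ (@GRing.opp R) expR);
    [exact: opp_continuous|exact: continuous_expR].
rewrite /Gamma.
transitivity
  (\int[lebesgue_measure]_(t in `](0 : R), +oo[) (t ^+ n * expR (- t))).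
  apply: eq_Rintegral => t; rewrite inE/= in_itv/= andbT => t0.
  by rewrite -natr1 addrK powR_mulrn// ltW.
have FTC : \int[lebesgue_measure]_(t in `[(0 : R), +oo[) (t ^+ n * expR (- t)) =
    0 - - upper_Gamma R n 0.
  apply: (Rintegral_ge0_continuous_FTC2y (F := fun t => - upper_Gamma R n t)).
  - by move=> x x0; rewrite mulr_ge0 ?exprn_ge0 ?expR_ge0.
  - exact: continuous_subspaceT.
  - by rewrite -oppr0; apply: cvgN; exact: cvg_upper_Gamma.
  - by move=> x _.
  - by apply: cvgN; apply: cvg_at_right_filter; exact: cG.
  - by move=> x _; rewrite derive1E derive_val opprK.
rewrite -(upper_Gamma0 R n) -[RHS]opprK -sub0r -FTC.
(* [Gamma] integrates over the open half-line and [FTC] over the closed one; the endpoint 0 is a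
   null set. *)
rewrite /Rintegral integral_itv_obnd_cbnd//.
by apply/measurable_EFinP; apply: measurable_funTS;
  exact: continuous_measurable_fun.
Qed.

Lemma coef_expr1DX (R : comNzRingType) n i :
  ((1 + 'X : {poly R}) ^+ n)`_i = 'C(n, i)%:R.
Proof.
rewrite addrC exprD1n coef_sum.
under eq_bigr do rewrite coefMn coefXn.
case: (ltnP i n.+1) => [lin|lni].
  rewrite (bigD1 (Ordinal lin)) //= eqxx big1 ?addr0 // => k.
  by rewrite -val_eqE /= eq_sym => /negPf ->; rewrite mul0rn.
rewrite bin_small // big1 // => k _.
by rewrite gtn_eqF ?mul0rn // (leq_trans (ltn_ord k)).
Qed.

(* Compare coefficients in [(1 + X)^d ((1 + X) - 1)^n = (1 + X)^d X^n]. *)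
Lemma alternating_sum_bin (R : comNzRingType) n d r :
  \sum_(0 <= l < n.+1) (-1) ^+ l * 'C(n, l)%:R * 'C(d + n - l, r)%:R =
  if (r < n)%N then 0 else 'C(d, r - n)%:R :> R.
Proof.
have : ('X^n * (1 + 'X) ^+ d : {poly R})`_r =
    if (r < n)%N then 0 else 'C(d, r - n)%:R.
  by rewrite coefXnM coef_expr1DX.
have -> : 'X^n = (1 + 'X - 1) ^+ n :> {poly R} by rewrite addrAC subrr add0r.
move=> <-; rewrite exprBn mulr_suml coef_sum big_mkord.
apply: eq_bigr => l _; rewrite expr1n mulr1 mulrnAl -!mulrA -exprD coefMn.
have -> : (n - l + d = d + n - l)%N by have := ltn_ord l; lia.
have -> : (-1) ^+ l = ((-1) ^+ l)%:P :> {poly R} by rewrite rmorphXn rmorphN1.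
by rewrite coefCM coef_expr1DX -[RHS]mulr_natr; ring.
Qed.

Lemma bin_factE (R : numFieldType) n k :
  (k <= n)%N -> 'C(n, k)%:R = n`!%:R / (k`!%:R * (n - k)`!%:R) :> R.
Proof.
by move=> kn; rewrite -natrM -(bin_fact kn) [(_ * (_ * _))%:R]natrM mulfK.
Qed.

Lemma fact_neq0 (R : numFieldType) n : n`!%:R != 0 :> R.
Proof. by rewrite pnatr_eq0 -lt0n fact_gt0. Qed.

(** The product C(n, j+1) (j+1) equals n! / (j! (n-j-1)!), so j! cancels and the beta value becomes
    a binomial coefficient times a constant free of j. *)
Lemma bin_mul_beta (R : numFieldType) n j m : (j < n)%N ->
  'C(n, j.+1)%:R * j.+1%:R * (j`!%:R * m`!%:R / (j + m).+1`!%:R) =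
  n`!%:R * m`!%:R / (n + m)`!%:R * 'C(n + m, n - j.+1)%:R :> R.
Proof.
move=> jn; rewrite !bin_factE //; last by lia.
have -> : (n + m - (n - j.+1) = (j + m).+1)%N by lia.
rewrite [j.+1`!]factS natrM.
field.
by rewrite !fact_neq0 addrC natr1 pnatr_eq0.
Qed.

(** By [bin_mul_beta] this is [alternating_sum_bin] with n + m, n - m - 1 and n + k for its n, d and
    r. *)
Lemma alternating_sum_beta (R : numFieldType) n k m : (m < n)%N ->
  \sum_(j < n) (-1) ^+ j.+1 * 'C(n, j.+1)%:R * j.+1%:R * 'C(n + j, n + k)%:R *
     (j`!%:R * m`!%:R / (j + m).+1`!%:R) =
  (-1) ^+ n * (n`!%:R * m`!%:R / (n + m)`!%:R) *
  (if (k < m)%N then 0 else 'C(n - m.+1, k - m)%:R) :> R.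
Proof.
move=> mn.
have := alternating_sum_bin R (n + m) (n - m.+1) (n + k).
rewrite ltn_add2l subnDl => <-.
(* The terms with l >= n vanish, since their upper index 2n - 1 - l is below n + k. *)
rewrite (big_cat_nat _ (n := n)) //=; last by lia.
rewrite [X in _ + X]big_nat [X in _ + X]big1 ?addr0; last first.
  by move=> l /andP[nl ln]; rewrite ['C(_ - _, _)]bin_small ?mulr0 //; lia.
(* The reversal j = n - 1 - l turns ['C(n + m, n - j.+1)] into ['C(n + m, l)]. *)
rewrite big_mkord mulr_sumr (reindex_inj rev_ord_inj) /=.
apply: eq_bigr => l _; have ln := ltn_ord l.
have := @bin_mul_beta R n (n - l.+1) m ltac:(lia).
set b := (_ / _); have -> : (n - (n - l.+1).+1 = l)%N by lia.
have -> : (n - m.+1 + (n + m) - l = n + (n - l.+1))%N by lia.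
have -> : (-1) ^+ (n - l.+1).+1 = (-1) ^+ n * (-1) ^+ l :> R.
  rewrite -exprD -[LHS]signr_odd -[RHS]signr_odd.
  by congr (_ ^+ _); congr nat_of_bool; lia.
set u := 'C(n, _)%:R; set v := _%:R => E.
transitivity ((-1) ^+ n * (-1) ^+ l * 'C(n + (n - l.+1), n + k)%:R *
  (u * v * b)); first by ring.
by rewrite E; ring.
Qed.

(** Only k = m + l with l >= 0 contributes, which leaves [alternating_sum_bin] with d = 0; its value
    C(0, m - i) for i <= m, and 0 for i > m, is the Kronecker delta. *)
Lemma alternating_sum_bin_bin (R : numFieldType) n i m : (i < n)%N -> (m < n)%N ->
  \sum_(k < n) (-1) ^+ k.+1 * 'C(n - k.+1, n - i.+1)%:R *
    (if (k < m)%N then 0 else 'C(n - m.+1, k - m)%:R) =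
  (-1) ^+ i.+1 * (i == m)%:R :> R.
Proof.
move=> lin mn.
rewrite -(big_mkord xpredT (fun k : nat =>
    (-1) ^+ k.+1 * 'C(n - k.+1, n - i.+1)%:R *
    (if (k < m)%N then 0 else 'C(n - m.+1, k - m)%:R))).
rewrite (big_cat_nat _ (n := m)) ?(ltnW mn) //=.
rewrite big_nat big1 ?add0r; last by move=> k /= ->; rewrite mulr0.
rewrite -{1}[m]add0n big_addn.
transitivity ((-1) ^+ m.+1 * \sum_(0 <= l < (n - m.+1).+1)
    (-1) ^+ l * 'C(n - m.+1, l)%:R * 'C(0 + (n - m.+1) - l, n - i.+1)%:R : R).
  rewrite mulr_sumr subnSK //; apply: eq_bigr => l _.
  rewrite ltnNge leq_addl /= addnK add0n -subnDA addSn [(m + l)%N]addnC.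
  by rewrite -addnS exprD; ring.
rewrite alternating_sum_bin; case: ifPn => [h|].
  by rewrite (_ : (i == m) = false) ?mulr0 //; lia.
rewrite -leqNgt => h; case: eqP => [->|im]; first by rewrite subnn bin0.
by rewrite bin0n (_ : (_ == 0)%N = false) ?mulr0 //; lia.
Qed.

(** Extending the sum over k to a range independent of i and j, and splitting the sign, prepares the
    exchange of summations in the matrix product. *)
Lemma beta_inv_entryE (R : numFieldType) n (i j : nat) : (i < n)%N -> (j < n)%N ->
  (beta_inv_entry n i.+1 j.+1)%:~R =
  (-1) ^+ (n + i).+1 * 'C(n + i, i)%:R *
  \sum_(k < n) (-1) ^+ k.+1 * 'C(n - k.+1, n - i.+1)%:R *
    ((-1) ^+ j.+1 * 'C(n, j.+1)%:R * j.+1%:R * 'C(n + j, n + k)%:R) :> R.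
Proof.
move=> lin jn; rewrite /beta_inv_entry big_add1 /= !addnS !subn1 /= subSS.
have -> : (-1) ^+ (n + i - j) = (-1) ^+ (n + i).+1 * (-1) ^+ j.+1 :> int.
  rewrite -exprD -[LHS]signr_odd -[RHS]signr_odd.
  by congr (_ ^+ _); congr nat_of_bool; lia.
rewrite !rmorphM /= !rmorphXn /= !rmorphN1 rmorph_sum /= !pmulrn.
rewrite -(big_mkord xpredT (fun k : nat =>
    (-1) ^+ k.+1 * 'C(n - k.+1, n - i.+1)%:R *
    ((-1) ^+ j.+1 * 'C(n, j.+1)%:R * j.+1%:R * 'C(n + j, n + k)%:R))).
rewrite [in RHS](big_cat_nat _ (n := minn i.+1 j.+1)) //=;
  last by rewrite geq_min lin.
(* An added index satisfies k > i or k > j, and the first or the second binomial coefficient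
   vanishes accordingly. *)
rewrite [X in _ * (_ + X)]big_nat [X in _ * (_ + X)]big1 ?addr0; last first.
  move=> k /andP[+ kn]; rewrite geq_min => /orP[] h.
    by rewrite ['C(n - _, _)]bin_small ?mulr0 ?mul0r //; lia.
  by rewrite ['C(n + j, _)]bin_small ?mulr0 //; lia.
rewrite !mulr_sumr; apply: eq_bigr => k _.
rewrite !rmorphM /= !rmorphXn /= !rmorphN1 addnS subn1 /= !pmulrn; ring.
Qed.

Lemma beta_natS (R : realType) (i j : nat) :
  beta (i.+1%:R : R) j.+1%:R = i`!%:R * j`!%:R / (i + j).+1`!%:R.
Proof. by rewrite /beta -natrD addSn addnS !Gamma_natS. Qed.

Lemma mul_beta_inv_matrix (R : realType) (n : nat) :
  (\matrix_(i < n, j < n) (beta_inv_entry n i.+1 j.+1)%:~R) *m beta_matrix R n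
  = 1%:M.
Proof.
apply/matrixP => i m; rewrite !mxE.
under eq_bigr => j _ do
  rewrite !mxE beta_natS beta_inv_entryE // -(mulrA _ (\sum_(k < n) _)) mulr_suml.
rewrite -mulr_sumr exchange_big /=.
under eq_bigr => k _.
  under eq_bigr => j _ do rewrite -(mulrA (_ * 'C(n - k.+1, _)%:R)).
  rewrite -mulr_sumr alternating_sum_beta // [_ ^+ n * _ * _]mulrAC mulrA.
  rewrite [_ * (_ ^+ n * _)]mulrCA.
  over.
rewrite -mulr_suml -mulr_sumr alternating_sum_bin_bin //.
have [->|im] := eqVneq i m; last first.
  by rewrite -val_eqE in im; rewrite (negPf im) !(mulr0, mul0r).
(* On the diagonal, C(n + m, m) is the reciprocal of n! m! / (n + m)!, and the three signs combine
   to the even exponent 2 (n + m + 1). *)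
rewrite eqxx mulr1 bin_factE ?leq_addl// addnK.
transitivity ((-1) ^+ ((n + m).+1 + n + m.+1) *
  ((n + m)`!%:R / (m`!%:R * n`!%:R) * (n`!%:R * m`!%:R / (n + m)`!%:R)) : R).
  by rewrite !exprD; ring.
rewrite [m`!%:R * _]mulrC mulrA divfK ?mulf_neq0 ?fact_neq0// divff ?fact_neq0//.
by rewrite -signr_odd (_ : odd _ = false) ?mulr1//; lia.
Qed.

Theorem theorem1p3 (R : realType) (n : nat) (hn : (1 <= n)%N) :
  [/\ beta_matrix R n \in unitmx,
      (forall i j : 'I_n, invmx (beta_matrix R n) i j \is a Num.int) &
      (forall i j : 'I_n,
         invmx (beta_matrix R n) i j = (beta_inv_entry n i.+1 j.+1)%:~R)].
Proof.
set A : 'M[R]_n := \matrix_(i, j) (beta_inv_entry n i.+1 j.+1)%:~R.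
have AB : A *m beta_matrix R n = 1%:M by exact: mul_beta_inv_matrix.
(* For square matrices a left inverse already gives invertibility. *)
have [_ uB] := mulmx1_unit AB.
have entry i j : invmx (beta_matrix R n) i j = (beta_inv_entry n i.+1 j.+1)%:~R.
  by rewrite -[invmx _]mul1mx -AB mulmxK// mxE.
by split => // i j; rewrite entry intr_int.
Qed.
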